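(* If $H$ is a Hopf algebra, the space $\Sigma(H)$ of Garsia–Reutenauer endomorphisms is a subalgebra of $\mathrm{End}(H)$ with respect to the Heisenberg product.
   Context: Spaces are over a field $\Bbbk$ of characteristic zero; Sweedler notation is used. $\mathrm{End}(H)$ is the space of linear endomorphisms of $H$, with the Heisenberg product $$(f\#g)(h)=\sum f(h_1)_2\,g\bigl(h_2\,f(h_1)_1\bigr),$$ which is associative with unit $\iota\varepsilon$ (unit composed with counit). $\mathrm{Prim}(H)=\{h\in H:\Delta(h)=h\otimes1+1\otimes h\}$. For $h_1,\dots,h_n\in H$, $G(h_1,\dots,h_n)$ is the linear span of the products $h_{\sigma(1)}\cdots h_{\sigma(n)}$, $\sigma\in S_n$; for $n=0$ this is $\Bbbk\cdot1$. The space of Garsia–Reutenauer endomorphisms is $$\Sigma(H)=\{f\in\mathrm{End}(H): f(G(h_1,\dots,h_n))\subseteq G(h_1,\dots,h_n)\text{ for all }n\ge0\text{ and all }h_1,\dots,h_n\in\mathrm{Prim}(H)\}.$$ *)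

(* Defs.v *)
From HB Require Import structures.
From mathcomp Require Import all_boot all_order all_algebra perm.
From mathcomp Require Import boolp.

Set Implicit Arguments.
Unset Strict Implicit.
Unset Printing Implicit Defensive.

Import GRing.Theory.

Local Open Scope ring_scope.
Local Open Scope quotient_scope.

(** A finite sequence of pairs (u_i, v_i) stands for the formal sum of the
    u_i (x) v_i.  Two formal sums are identified when no bilinear map, into any
    vector space, distinguishes them; [tensor_universal] below is the universal
    property of the resulting quotient. *)

Section TensorType.
Variables (k : fieldType) (U V : lmodType k).

Definition bsum (W : lmodType k) (b : U -> V -> W) (s : seq (U * V)) : W :=
  \sum_(p <- s) b p.1 p.2.

Definition tensor_eq (s t : seq (U * V)) : bool :=
  `[< forall (W : lmodType k) (b : U -> V -> W),
        bilinear_for *:%R *:%R b -> bsum b s = bsum b t >].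

Fact tensor_eq_refl : reflexive tensor_eq.
Proof. by move=> s; apply/asboolP. Qed.

Fact tensor_eq_sym : symmetric tensor_eq.
Proof.
by move=> s t; apply/asboolP/asboolP => H W b bb; rewrite (H W b bb).
Qed.

Fact tensor_eq_trans : transitive tensor_eq.
Proof.
move=> t s r /asboolP H1 /asboolP H2; apply/asboolP => W b bb.
by rewrite (H1 W b bb) (H2 W b bb).
Qed.

Canonical tensor_eq_equiv :=
  EquivRel tensor_eq tensor_eq_refl tensor_eq_sym tensor_eq_trans.

Definition tensor := {eq_quot tensor_eq}.
HB.instance Definition _ := Choice.on tensor.
HB.instance Definition _ := EqQuotient.on tensor.

Definition tens (u : U) (v : V) : tensor := \pi_tensor [:: (u, v)].

(** [tlift b x] is Sweedler's sum of the b(x_1, x_2); it does not depend on the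
    chosen representative of x as soon as b is bilinear ([tlift_pi]). *)
Definition tlift (W : lmodType k) (b : U -> V -> W) (x : tensor) : W :=
  bsum b (repr x).

Lemma tlift_pi (W : lmodType k) (b : U -> V -> W) s :
  bilinear_for *:%R *:%R b -> tlift b (\pi_tensor s) = bsum b s.
Proof.
move=> bb; rewrite /tlift.
have /eqmodP/asboolP : repr (\pi_tensor s) = s %[mod tensor] by rewrite reprK.
by apply.
Qed.

Lemma tensor_ext (x y : tensor) :
  (forall (W : lmodType k) (b : U -> V -> W),
      bilinear_for *:%R *:%R b -> tlift b x = tlift b y) -> x = y.
Proof. by move=> H; rewrite -[x]reprK -[y]reprK; apply/eqmodP/asboolP. Qed.

Definition tensor_zero : tensor := \pi_tensor [::].
Definition tensor_add (x y : tensor) : tensor := \pi_tensor (repr x ++ repr y).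
Definition tensor_scale (c : k) (x : tensor) : tensor :=
  \pi_tensor [seq (c *: p.1, p.2) | p <- repr x].
Definition tensor_opp (x : tensor) : tensor := tensor_scale (-1) x.

Section Lift.
Variables (W : lmodType k) (b : U -> V -> W).
Hypothesis bb : bilinear_for *:%R *:%R b.

Fact tlift_zero : tlift b tensor_zero = 0.
Proof. by rewrite tlift_pi // /bsum big_nil. Qed.

Fact tlift_add x y : tlift b (tensor_add x y) = tlift b x + tlift b y.
Proof. by rewrite tlift_pi // /bsum big_cat. Qed.

Fact tlift_scale c x : tlift b (tensor_scale c x) = c *: tlift b x.
Proof.
rewrite tlift_pi // /bsum big_map scaler_sumr; apply: eq_bigr => p _ /=.
exact: (scalable_linear (bb.1 p.2)).
Qed.

Fact tlift_opp x : tlift b (tensor_opp x) = - tlift b x.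
Proof. by rewrite tlift_scale scaleN1r. Qed.

End Lift.

Fact tensor_addA : associative tensor_add.
Proof. by move=> x y z; apply: tensor_ext => W b bb; rewrite !tlift_add ?addrA. Qed.
Fact tensor_addC : commutative tensor_add.
Proof. by move=> x y; apply: tensor_ext => W b bb; rewrite !tlift_add // addrC. Qed.
Fact tensor_add0 : left_id tensor_zero tensor_add.
Proof.
by move=> x; apply: tensor_ext => W b bb; rewrite tlift_add // tlift_zero ?add0r.
Qed.
Fact tensor_addN : left_inverse tensor_zero tensor_opp tensor_add.
Proof.
move=> x; apply: tensor_ext => W b bb.
by rewrite tlift_add // tlift_opp // tlift_zero // addNr.
Qed.

HB.instance Definition _ :=
  GRing.isZmodule.Build tensor tensor_addA tensor_addC tensor_add0 tensor_addN.

Fact tensor_scaleA c d x :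
  tensor_scale c (tensor_scale d x) = tensor_scale (c * d) x.
Proof. by apply: tensor_ext => W b bb; rewrite !tlift_scale // scalerA. Qed.
Fact tensor_scale1 : left_id 1 tensor_scale.
Proof. by move=> x; apply: tensor_ext => W b bb; rewrite tlift_scale // scale1r. Qed.
Fact tensor_scaleDr : right_distributive tensor_scale +%R.
Proof.
move=> c x y; apply: tensor_ext => W b bb.
by rewrite tlift_scale // !tlift_add // !tlift_scale // scalerDr.
Qed.
Fact tensor_scaleDl x : {morph tensor_scale^~ x : c d / c + d}.
Proof.
move=> c d; apply: tensor_ext => W b bb.
by rewrite tlift_add // !tlift_scale // scalerDl.
Qed.

HB.instance Definition _ := GRing.Zmodule_isLmodule.Build k tensor
  tensor_scaleA tensor_scale1 tensor_scaleDr tensor_scaleDl.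

Lemma tlift_linear (W : lmodType k) (b : U -> V -> W) :
  bilinear_for *:%R *:%R b -> linear (tlift b).
Proof.
by move=> bb a x y; rewrite -(tlift_scale bb) -(tlift_add bb).
Qed.

Lemma tlift_tens (W : lmodType k) (b : U -> V -> W) u v :
  bilinear_for *:%R *:%R b -> tlift b (tens u v) = b u v.
Proof. by move=> bb; rewrite tlift_pi // /bsum big_seq1. Qed.

Lemma tens_bilinear : bilinear_for *:%R *:%R tens.
Proof.
by split=> [v a u u' | u a v v']; apply: tensor_ext => W b bb;
  rewrite (tlift_linear bb) !tlift_tens // ?bb.1 ?bb.2.
Qed.

Lemma tensor_sum (x : tensor) : x = tlift tens x.
Proof.
apply: tensor_ext => W b bb.
have bl := tlift_linear bb.
pose L := GRing.isLinear.Build k tensor W *:%R (tlift b) bl.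
pose B : {linear tensor -> W} := HB.pack (tlift b) L.
rewrite /(tlift tens) /bsum -[tlift b (\sum_(_ <- _) _)]/(B _) linear_sum /=.
by apply: eq_bigr => p _; rewrite tlift_tens.
Qed.

Lemma tensor_universal (W : lmodType k) (b : U -> V -> W) :
  bilinear_for *:%R *:%R b ->
  exists! F : tensor -> W, linear F /\ forall u v, F (tens u v) = b u v.
Proof.
move=> bb; exists (tlift b); split.
  by split; [exact: tlift_linear | move=> u v; exact: tlift_tens].
move=> F [Flin FE]; apply/funext => x; rewrite {2}[x]tensor_sum.
pose L := GRing.isLinear.Build k tensor W *:%R F Flin.
pose B : {linear tensor -> W} := HB.pack F L.
rewrite {2}/tlift /bsum -[F (\sum_(_ <- _) _)]/(B _) linear_sum /=.
by apply: eq_bigr => p _; rewrite FE.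
Qed.

End TensorType.

Arguments tensor {k} (U V)%_type_scope.
Arguments tens {k U V} u v.

Reserved Notation "U ⊗ V" (at level 40, left associativity).
Notation "U ⊗ V" := (tensor U V) : type_scope.
Notation "u ⊗ v" := (tens u v) : ring_scope.

Section TensorOps.
Variable k : fieldType.

Definition tmap (U U' V V' : lmodType k) (f : U -> U') (g : V -> V')
  : U ⊗ V -> U' ⊗ V' := tlift (fun u v => f u ⊗ g v).

Definition tassoc (U V W : lmodType k) : (U ⊗ V) ⊗ W -> U ⊗ (V ⊗ W) :=
  tlift (fun p w => tlift (fun u v => u ⊗ (v ⊗ w)) p).

Definition tmul (A B : algType k) (x y : A ⊗ B) : A ⊗ B :=
  tlift (fun a b => tlift (fun a' b' => (a * a') ⊗ (b * b')) y) x.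

End TensorOps.

HB.mixin Record Lmodule_isCoalgebra (k : fieldType) C of GRing.Lmodule k C := {
  comul : {linear C -> (C ⊗ C)%type};
  counit : {scalar C};
  comulA : forall h : C,
    tassoc (tmap comul idfun (comul h)) = tmap idfun comul (comul h);
  counitl : forall h : C, tlift (fun a b => counit a *: b) (comul h) = h;
  counitr : forall h : C, tlift (fun a b => counit b *: a) (comul h) = h
}.

#[short(type="coalgType")]
HB.structure Definition Coalgebra (k : fieldType) :=
  {C of GRing.Lmodule k C & Lmodule_isCoalgebra k C}.

HB.mixin Record AlgebraCoalgebra_isBialgebra (k : fieldType) H
    of GRing.Algebra k H & Coalgebra k H := {
  comul1 : comul (1 : H) = 1 ⊗ 1;
  comulM : forall x y : H, comul (x * y) = tmul (comul x) (comul y);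
  counit1 : counit (1 : H) = 1;
  counitM : forall x y : H, counit (x * y) = counit x * counit y
}.

#[short(type="bialgType")]
HB.structure Definition Bialgebra (k : fieldType) :=
  {H of GRing.Algebra k H & Coalgebra k H & AlgebraCoalgebra_isBialgebra k H}.

HB.mixin Record Bialgebra_isHopf (k : fieldType) H of Bialgebra k H := {
  antipode : {linear H -> H};
  antipodel : forall h : H,
    tlift (fun a b => antipode a * b) (comul h) = (counit h)%:A;
  antipoder : forall h : H,
    tlift (fun a b => a * antipode b) (comul h) = (counit h)%:A
}.

#[short(type="hopfAlgType")]
HB.structure Definition Hopf (k : fieldType) :=
  {H of Bialgebra k H & Bialgebra_isHopf k H}.

Section SweedlerCalculus.
Variable k : fieldType.
Implicit Types U V W X : lmodType k.

Lemma eq_tlift U V W (b b' : U -> V -> W) x :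
  (forall u v, b u v = b' u v) -> tlift b x = tlift b' x.
Proof. by move=> E; apply: eq_bigr => p _; exact: E. Qed.

Lemma linear_tlift U V W X (F : W -> X) (b : U -> V -> W) x :
  linear F -> F (tlift b x) = tlift (fun u v => F (b u v)) x.
Proof.
move=> Flin; pose L := GRing.isLinear.Build k W X *:%R F Flin.
pose B : {linear W -> X} := HB.pack F L.
by rewrite /tlift /bsum -[F _]/(B _) linear_sum.
Qed.

Lemma tlift_linearP U V W X (b : X -> U -> V -> W) t :
  (forall u v, linear (fun x => b x u v)) -> linear (fun x => tlift (b x) t).
Proof.
move=> bl a x y; rewrite /tlift /bsum scaler_sumr -big_split /=.
by apply: eq_bigr => p _; exact: bl.
Qed.

Lemma exchange_tlift U V U' V' W (b : U -> V -> U' -> V' -> W) x y :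
  tlift (fun u v => tlift (b u v) y) x =
  tlift (fun u' v' => tlift (fun u v => b u v u' v') x) y.
Proof. by rewrite /tlift /bsum exchange_big. Qed.

Lemma comp_linear U V W (f : V -> W) (g : U -> V) :
  linear f -> linear g -> linear (fun x => f (g x)).
Proof. by move=> fl gl a x y; rewrite gl fl. Qed.

Lemma mulr_lin_l (A : algType k) (y : A) : linear (fun x => x * y).
Proof. by move=> a u v; rewrite mulrDl scalerAl. Qed.

Lemma mulr_lin_r (A : algType k) (y : A) : linear (fun x => y * x).
Proof. by move=> a u v; rewrite mulrDr scalerAr. Qed.

Lemma linear_fun U V (f : {linear U -> V}) : linear f.
Proof. by move=> a u v; rewrite linearP. Qed.

Lemma tlift_coassoc (C : coalgType k) W (t : C -> C -> C -> W) h :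
  (forall v w, linear (fun u => t u v w)) ->
  (forall u w, linear (fun v => t u v w)) ->
  (forall u v, linear (t u v)) ->
  tlift (fun a b => tlift (fun x y => t x y b) (comul a)) (comul h) =
  tlift (fun a b => tlift (fun x y => t a x y) (comul b)) (comul h).
Proof.
move=> t1 t2 t3.
have bt a : bilinear_for *:%R *:%R (t a) by split=> w; [exact: t2 | exact: t3].
have bT : bilinear_for *:%R *:%R (fun a (p : C ⊗ C) => tlift (t a) p).
  split=> [p|a]; last exact: tlift_linear.
  by apply: tlift_linearP => u v; exact: t1.
have bten := @tens_bilinear k.
have lmap U U' (f : U -> U') V : linear f ->
    bilinear_for *:%R *:%R (fun u (v : V) => f u ⊗ v).
  move=> fl; split=> [v|u]; last exact: (bten _ _).2.
  by apply: (comp_linear (f := fun u => u ⊗ v)) => //; exact: (bten _ _).1.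
have rmap U U' (f : U -> U') V : linear f ->
    bilinear_for *:%R *:%R (fun (v : V) u => v ⊗ f u).
  move=> fl; split=> [u|v]; first exact: (bten _ _).1.
  by apply: (comp_linear (f := tens v)) => //; exact: (bten _ _).2.
have lcom := linear_fun (@comul k C).
have bin w : bilinear_for *:%R *:%R (fun u v : C => u ⊗ (v ⊗ w : C ⊗ C)).
  split=> [v|u]; first exact: (bten _ _).1.
  apply: (comp_linear (f := tens u)); first exact: (bten _ _).2.
  exact: (bten _ _).1.
have bass : bilinear_for *:%R *:%R
    (fun (p : C ⊗ C) (w : C) => tlift (fun u v => u ⊗ (v ⊗ w)) p).
  split=> [w|p]; first exact: tlift_linear.
  apply: tlift_linearP => u v; apply: (comp_linear (f := tens u)).
    exact: (bten _ _).2.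
  exact: (bten _ _).2.
have := congr1 (tlift (fun a (p : C ⊗ C) => tlift (t a) p)) (comulA h).
have lT := tlift_linear bT.
rewrite /tassoc /tmap [X in tlift _ X = _](linear_tlift _ _ (tlift_linear bass)).
rewrite !(linear_tlift _ _ lT) => E.
apply: etrans (etrans E _).
  apply: eq_tlift => a b; rewrite (tlift_tens _ _ bass) (linear_tlift _ _ lT).
  by apply: eq_tlift => u v; rewrite tlift_tens ?tlift_tens.
by apply: eq_tlift => a b; rewrite tlift_tens.
Qed.

Lemma tlift_comulM (H : bialgType k) W (b : H -> H -> W) x y :
  bilinear_for *:%R *:%R b ->
  tlift b (comul (x * y)) =
  tlift (fun x1 x2 => tlift (fun y1 y2 => b (x1 * y1) (x2 * y2)) (comul y))
        (comul x).
Proof.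
move=> bb; have bl := tlift_linear bb.
rewrite comulM /tmul (linear_tlift _ _ bl); apply: eq_tlift => u v.
by rewrite (linear_tlift _ _ bl); apply: eq_tlift => u' v'; rewrite tlift_tens.
Qed.

End SweedlerCalculus.

(** Linear endomorphisms of H, with the Heisenberg product as multiplication
    (not composition); the alias keeps this algebra structure, whose
    multiplication and unit are spelled out in [heisE] and [heis1E], off the
    bare type of linear maps. *)
Definition heis_end (k : fieldType) (H : hopfAlgType k) := {linear H -> H}.
Identity Coercion heis_end_linear : heis_end >-> GRing.Linear.type.

Section HeisenbergModule.
Variables (k : fieldType) (H : hopfAlgType k).
Implicit Types f g : heis_end H.

HB.instance Definition _ := gen_eqMixin (heis_end H).
HB.instance Definition _ := gen_choiceMixin (heis_end H).

Lemma heis_endP f g : f =1 g -> f = g.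
Proof.
case: f => [f [[fD] [fZ]]]; case: g => [g [[gD] [gZ]]] /= /funext E.
case: _ / E gD gZ => gD gZ.
by rewrite (Prop_irrelevance fD gD) (Prop_irrelevance fZ gZ).
Qed.

Definition heis_zero : heis_end H := \0.
Definition heis_opp f : heis_end H := \- f.
Definition heis_add f g : heis_end H := f \+ g.
Definition heis_scale (c : k) f : heis_end H := c \*: f.

Fact heis_addA : associative heis_add.
Proof. by move=> f g h; apply: heis_endP => x /=; rewrite addrA. Qed.
Fact heis_addC : commutative heis_add.
Proof. by move=> f g; apply: heis_endP => x /=; rewrite addrC. Qed.
Fact heis_add0 : left_id heis_zero heis_add.
Proof. by move=> f; apply: heis_endP => x /=; rewrite add0r. Qed.
Fact heis_addN : left_inverse heis_zero heis_opp heis_add.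
Proof. by move=> f; apply: heis_endP => x /=; rewrite addNr. Qed.

HB.instance Definition _ :=
  GRing.isZmodule.Build (heis_end H) heis_addA heis_addC heis_add0 heis_addN.

Fact heis_scaleA c d f : heis_scale c (heis_scale d f) = heis_scale (c * d) f.
Proof. by apply: heis_endP => x /=; rewrite scalerA. Qed.
Fact heis_scale1 : left_id 1 heis_scale.
Proof. by move=> f; apply: heis_endP => x /=; rewrite scale1r. Qed.
Fact heis_scaleDr : right_distributive heis_scale +%R.
Proof. by move=> c f g; apply: heis_endP => x /=; rewrite scalerDr. Qed.
Fact heis_scaleDl f : {morph heis_scale^~ f : c d / c + d}.
Proof. by move=> c d; apply: heis_endP => x /=; rewrite scalerDl. Qed.

HB.instance Definition _ := GRing.Zmodule_isLmodule.Build k (heis_end H)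
  heis_scaleA heis_scale1 heis_scaleDr heis_scaleDl.

Lemma heis_addE f g x : (f + g) x = f x + g x. Proof. by []. Qed.
Lemma heis_scaleE c f x : (c *: f) x = c *: f x. Proof. by []. Qed.

Definition heis_fun (f g : H -> H) (h : H) : H :=
  tlift (fun h1 h2 =>
    tlift (fun fh1_1 fh1_2 => fh1_2 * g (h2 * fh1_1)) (comul (f h1))) (comul h).

Let inner_bilinear (g : H -> H) b : linear g ->
  bilinear_for *:%R *:%R (fun x y => y * g (b * x)).
Proof.
move=> gl; split=> [y|x]; last exact: mulr_lin_l.
apply: (comp_linear (f := fun z => y * g z)); last exact: mulr_lin_r.
by apply: (comp_linear (f := fun z => y * z)) => //; exact: mulr_lin_r.
Qed.

Let inner_linear (g : H -> H) b : linear g ->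
  linear (fun a => tlift (fun x y => y * g (b * x)) (comul a)).
Proof.
move=> gl; apply: (comp_linear (f := tlift _)); last exact: linear_fun.
exact: tlift_linear (inner_bilinear b gl).
Qed.

Let outer_bilinear (f g : H -> H) : linear f -> linear g ->
  bilinear_for *:%R *:%R
    (fun a b => tlift (fun x y => y * g (b * x)) (comul (f a))).
Proof.
move=> fl gl; split=> [b|a].
  apply: (comp_linear (f := fun a => tlift _ (comul a))) => //.
  exact: inner_linear.
apply: tlift_linearP => x y.
apply: (comp_linear (f := fun z => y * z)); first exact: mulr_lin_r.
by apply: (comp_linear (f := g)) => //; exact: mulr_lin_l.
Qed.

Fact heis_fun_linear f g : linear (heis_fun f g).
Proof.
apply: (comp_linear (f := tlift _)); last exact: linear_fun.
by apply: tlift_linear; apply: outer_bilinear; exact: linear_fun.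
Qed.

HB.instance Definition _ f g :=
  GRing.isLinear.Build k H H *:%R (heis_fun f g) (heis_fun_linear f g).

Definition heis_mul f g : heis_end H := heis_fun f g.

Definition heis_unit_fun (h : H) : H := (counit h)%:A.

Fact heis_unit_fun_linear : linear heis_unit_fun.
Proof. by move=> a x y; rewrite /heis_unit_fun linearP scalerDl scalerA. Qed.

HB.instance Definition _ :=
  GRing.isLinear.Build k H H *:%R heis_unit_fun heis_unit_fun_linear.

Definition heis_one : heis_end H := heis_unit_fun.

Lemma heis_mulE f g h : heis_mul f g h =
  tlift (fun h1 h2 => tlift (fun x y => y * g (h2 * x)) (comul (f h1)))
        (comul h).
Proof. by []. Qed.

Lemma heis_oneE h : heis_one h = (counit h)%:A. Proof. by []. Qed.

Let summand_linear (g q : H -> H) b c s1 s2 : linear g -> linear q ->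
  linear (fun r => tlift (fun w1 w2 => s2 * w2 * q (b * (s1 * w1)))
                         (comul (g (c * r)))).
Proof.
move=> gl ql; apply: (comp_linear (f := fun z => tlift _ (comul (g z)))).
  apply: (comp_linear (f := fun z => tlift _ (comul z))) => //.
  apply: (comp_linear (f := tlift _)); last exact: linear_fun.
  apply: tlift_linear; split=> [y|x].
    apply: (comp_linear (f := fun z => s2 * y * z)); first exact: mulr_lin_r.
    apply: (comp_linear (f := q)) => //.
    by apply: (comp_linear (f := fun z => b * z)); exact: mulr_lin_r.
  apply: (comp_linear (f := fun z => z * _)); first exact: mulr_lin_l.
  exact: mulr_lin_r.
exact: mulr_lin_r.
Qed.

Let summand_linear1 (q : H -> H) b s2 w : linear q ->
  linear (fun s1 => tlift (fun w1 w2 => s2 * w2 * q (b * (s1 * w1))) w).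
Proof.
move=> ql; apply: tlift_linearP => w1 w2.
apply: (comp_linear (f := fun z => s2 * w2 * z)); first exact: mulr_lin_r.
apply: (comp_linear (f := q)) => //.
apply: (comp_linear (f := fun z => b * z)); first exact: mulr_lin_r.
exact: mulr_lin_l.
Qed.

Let summand_linear2 (q : H -> H) b s1 w :
  linear (fun s2 => tlift (fun w1 w2 => s2 * w2 * q (b * (s1 * w1))) w).
Proof.
apply: tlift_linearP => w1 w2.
by apply: (comp_linear (f := fun z => z * _)); exact: mulr_lin_l.
Qed.

Fact heis_mulA : associative heis_mul.
Proof.
move=> f g q; apply: heis_endP => h; apply/esym; rewrite !heis_mulE.
have [[fl gl] ql] := (linear_fun f, linear_fun g, linear_fun q).
pose u b c r s1 s2 := tlift (fun w1 w2 => s2 * w2 * q (b * (s1 * w1)))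
                            (comul (g (c * r))).
pose t p c b := tlift (fun r s => tlift (fun s1 s2 => u b c r s1 s2) (comul s))
                      (comul (f p)).
transitivity (tlift (fun a b => tlift (fun p c => t p c b) (comul a)) (comul h)).
  apply: eq_tlift => a b; rewrite heis_mulE.
  have Kl := inner_linear b ql.
  rewrite (linear_tlift _ _ Kl); apply: eq_tlift => p c.
  rewrite (linear_tlift _ _ Kl); apply: eq_tlift => r s.
  by rewrite tlift_comulM //; exact: inner_bilinear.
rewrite tlift_coassoc.
- apply: eq_tlift => a b.
  transitivity (tlift (fun c d =>
      tlift (fun x y => tlift (fun x1 x2 => u d c x1 x2 y) (comul x))
            (comul (f a))) (comul b)).
    apply: eq_tlift => c d; rewrite /t; apply/esym; apply: tlift_coassoc.
    + by move=> v w; exact: summand_linear.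
    + by move=> v w; exact: summand_linear1.
    + by move=> v w; exact: summand_linear2.
  rewrite exchange_tlift; apply: eq_tlift => x y.
  rewrite heis_mulE tlift_comulM; last exact: outer_bilinear.
  rewrite (linear_tlift _ _ (mulr_lin_r y)); apply: eq_tlift => c d.
  rewrite (linear_tlift _ _ (mulr_lin_r y)); apply: eq_tlift => x1 x2.
  rewrite (linear_tlift _ _ (mulr_lin_r y)); apply: eq_tlift => w1 w2.
  by rewrite !mulrA.
- move=> c b; apply: (comp_linear (f := fun z => tlift _ (comul z))) => //.
  apply: (comp_linear (f := tlift _)); last exact: linear_fun.
  apply: tlift_linear; split=> [s|r].
    by apply: tlift_linearP => s1 s2; exact: summand_linear.
  apply: (comp_linear (f := tlift _)); last exact: linear_fun.
  apply: tlift_linear; split=> [s2|s1]; first exact: summand_linear1.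
  exact: summand_linear2.
- move=> p b; apply: tlift_linearP => r s; apply: tlift_linearP => s1 s2.
  apply: (comp_linear (f := fun z => tlift _ (comul (g z)))); last first.
    exact: mulr_lin_l.
  have := summand_linear b 1 s1 s2 gl ql.
  by congr (linear _); apply/funext => z; rewrite mul1r.
- move=> p c; do 3!apply: tlift_linearP => ? ?.
  apply: (comp_linear (f := fun z => _ * z)); first exact: mulr_lin_r.
  by apply: (comp_linear (f := q)) => //; exact: mulr_lin_l.
Qed.

Fact heis_mul1 : left_id heis_one heis_mul.
Proof.
move=> f; apply: heis_endP => h; rewrite heis_mulE -{2}[h]counitl.
rewrite (linear_tlift _ _ (linear_fun f)); apply: eq_tlift => a b.
rewrite heis_oneE linearZ /= comul1.
have bb := inner_bilinear b (linear_fun f).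
rewrite -[LHS]addr0 (tlift_scale bb) addr0 tlift_tens //.
by rewrite mulr1 mul1r linearZ.
Qed.

Fact heis_mulr1 : right_id heis_one heis_mul.
Proof.
move=> f; apply: heis_endP => h; rewrite heis_mulE -{2}[h]counitr.
rewrite (linear_tlift _ _ (linear_fun f)); apply: eq_tlift => a b.
rewrite linearZ /= -{2}[f a]counitl.
rewrite (linear_tlift (F := fun z => counit b *: z)).
  apply: eq_tlift => x y.
  by rewrite heis_oneE counitM -scalerAr mulr1 scalerA.
by move=> c v w; rewrite scalerDr !scalerA mulrC.
Qed.

Fact heis_mulDl : left_distributive heis_mul +%R.
Proof.
move=> f g q; apply: heis_endP => h; rewrite heis_addE !heis_mulE.
rewrite /tlift /bsum -big_split; apply: eq_bigr => p _ /=.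
by have := inner_linear p.2 (linear_fun q) 1 (f p.1) (g p.1); rewrite !scale1r.
Qed.

Fact heis_mulDr : right_distributive heis_mul +%R.
Proof.
move=> f g q; apply: heis_endP => h; rewrite heis_addE !heis_mulE.
rewrite /tlift /bsum -big_split; apply: eq_bigr => p _ /=.
rewrite -big_split; apply: eq_bigr => r _ /=.
by rewrite -mulrDr.
Qed.

Fact heis_one_neq0 : heis_one != 0.
Proof.
apply/eqP => /(congr1 (fun f : heis_end H => f 1)); rewrite heis_oneE counit1.
by rewrite scale1r => /eqP; rewrite oner_eq0.
Qed.

HB.instance Definition _ := GRing.Zmodule_isNzRing.Build (heis_end H)
  heis_mulA heis_mul1 heis_mulr1 heis_mulDl heis_mulDr heis_one_neq0.

Fact heis_scaleAl c f g : c *: (f * g) = (c *: f) * g.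
Proof.
apply: heis_endP => h; rewrite heis_scaleE !heis_mulE.
rewrite /tlift /bsum scaler_sumr; apply: eq_bigr => p _ /=.
exact/esym/(scalable_linear (inner_linear p.2 (linear_fun g))).
Qed.

HB.instance Definition _ :=
  GRing.Lmodule_isLalgebra.Build k (heis_end H) heis_scaleAl.

Fact heis_scaleAr c f g : c *: (f * g) = f * (c *: g).
Proof.
apply: heis_endP => h; rewrite heis_scaleE !heis_mulE.
rewrite /tlift /bsum scaler_sumr; apply: eq_bigr => p _ /=.
rewrite scaler_sumr; apply: eq_bigr => r _ /=.
by rewrite scalerAr.
Qed.

HB.instance Definition _ :=
  GRing.Lalgebra_isAlgebra.Build k (heis_end H) heis_scaleAr.

Lemma heisE f g h : (f * g) h =
  tlift (fun h1 h2 =>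
    tlift (fun fh1_1 fh1_2 => fh1_2 * g (h2 * fh1_1)) (comul (f h1))) (comul h).
Proof. by []. Qed.

Lemma heis1E h : (1 : heis_end H) h = (counit h)%:A. Proof. by []. Qed.

End HeisenbergModule.

Section GarsiaReutenauer.
Variables (k : fieldType) (H : hopfAlgType k).

Definition primitive (h : H) : Prop := comul h = h ⊗ 1 + 1 ⊗ h.

(** For n = 0 the only product is the empty one, so the span is k.1. *)
Definition perm_span (n : nat) (h : 'I_n -> H) (x : H) : Prop :=
  exists c : {perm 'I_n} -> k,
    x = \sum_(s : {perm 'I_n}) c s *: \prod_(i < n) h (s i).

(** Boolean-valued because [GRing.subalg_closed] expects a collective predicate;
    the property is undecidable, hence the classical reflection. *)
Definition garsia_reutenauer : {pred heis_end H} := fun f =>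
  `[< forall (n : nat) (h : 'I_n -> H), (forall i, primitive (h i)) ->
      forall x, perm_span h x -> perm_span h (f x) >].

End GarsiaReutenauer.

(* Main.v *)
Require Import Defs.
From mathcomp Require Import all_boot all_order all_algebra perm.
From mathcomp Require Import boolp.

Set Implicit Arguments.
Unset Strict Implicit.
Unset Printing Implicit Defensive.

Import GRing.Theory.

Local Open Scope ring_scope.

(** The coproduct of a product of primitive elements is the sum, over all
    splittings of the factors into two complementary subwords, of the tensor of
    the two subproducts.  Hence comul sends G(s) into the sum of the
    G(s1) ⊗ G(s2) over the splittings s = s1 + s2 of the multiset s, while
    G(s1) G(s2) is contained in G(s1 + s2).  In the Heisenberg product every
    factor is thus used exactly once, whichever splittings occur. *)

Section PermutationSpan.
Variables (k : fieldType) (H : algType k).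
Implicit Types (s t : seq H) (x y : H).

(** G(s); indexing by sequences up to perm_eq instead of families over 'I_n lets
    splittings of the factors be written with ++. *)
Inductive gspan s : H -> Prop :=
| gspan0 : gspan s 0
| gspan_cons c t x : perm_eq t s -> gspan s x ->
    gspan s (c *: \prod_(y <- t) y + x).

Lemma gspan_prod s t : perm_eq t s -> gspan s (\prod_(y <- t) y).
Proof.
move=> st; rewrite -[X in gspan _ X]scale1r -[X in gspan _ X]addr0.
by apply: gspan_cons => //; exact: gspan0.
Qed.

Lemma gspan_nil1 : gspan [::] 1.
Proof. by have := gspan_prod (perm_refl [::]); rewrite big_nil. Qed.

Lemma gspan_seq1 x : gspan [:: x] x.
Proof. by have := gspan_prod (perm_refl [:: x]); rewrite big_seq1. Qed.

Lemma gspanD s x y : gspan s x -> gspan s y -> gspan s (x + y).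
Proof.
move=> sx sy; elim: sx => [|c t z st _ IH]; first by rewrite add0r.
by rewrite -addrA; exact: gspan_cons.
Qed.

Lemma gspanZ s c x : gspan s x -> gspan s (c *: x).
Proof.
elim=> [|d t y st _ IH]; first by rewrite scaler0; exact: gspan0.
by rewrite scalerDr scalerA; exact: gspan_cons.
Qed.

Lemma gspan_perm s t x : perm_eq s t -> gspan s x -> gspan t x.
Proof.
move=> st; elim=> [|c r y rs _ IH]; first exact: gspan0.
by apply: gspan_cons => //; exact: perm_trans rs st.
Qed.

Lemma gspanM s t x y : gspan s x -> gspan t y -> gspan (s ++ t) (x * y).
Proof.
move=> sx ty; elim: sx => [|c r z rs _ IH].
  by rewrite mul0r; exact: gspan0.
rewrite mulrDl -scalerAl; apply: gspanD (IH); apply: gspanZ.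
elim: ty => [|d q w qt _ IHw]; first by rewrite mulr0; exact: gspan0.
rewrite mulrDr -scalerAr; apply: gspanD (IHw); apply: gspanZ.
by rewrite -big_cat; apply: gspan_prod; exact: perm_cat.
Qed.

(** The sum of the G(s1) ⊗ G(s2) over the splittings of s. *)
Inductive tspan s : (H ⊗ H)%type -> Prop :=
| tspan0 : tspan s 0
| tspan_cons s1 s2 u v z : perm_eq (s1 ++ s2) s -> gspan s1 u -> gspan s2 v ->
    tspan s z -> tspan s (u ⊗ v + z).

Lemma tspan_tens s s1 s2 u v :
  perm_eq (s1 ++ s2) s -> gspan s1 u -> gspan s2 v -> tspan s (u ⊗ v).
Proof.
move=> p gu gv; rewrite -[_ ⊗ _]addr0.
by apply: tspan_cons p gu gv _; exact: tspan0.
Qed.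

Lemma tspanD s z w : tspan s z -> tspan s w -> tspan s (z + w).
Proof.
move=> sz sw; elim: sz => [|s1 s2 u v r p gu gv _ IH]; first by rewrite add0r.
by rewrite -addrA; exact: tspan_cons p gu gv IH.
Qed.

Lemma tspan_perm s t z : perm_eq s t -> tspan s z -> tspan t z.
Proof.
move=> st; elim=> [|s1 s2 u v r p gu gv _ IH]; first exact: tspan0.
by apply: tspan_cons gu gv IH; exact: perm_trans p st.
Qed.

(** Closure principle for Sweedler sums: membership of the whole sum is checked one splitting at a
    time. It serves both the coproduct of a product and the two nested sums of the Heisenberg
    product. *)
Lemma tlift_tspan (W : lmodType k) (P : W -> Prop) (b : H -> H -> W) s z :
    bilinear_for *:%R *:%R b ->
    P 0 -> (forall x y : W, P x -> P y -> P (x + y)) ->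
    (forall s1 s2 u v, perm_eq (s1 ++ s2) s -> gspan s1 u -> gspan s2 v ->
      P (b u v)) ->
  tspan s z -> P (tlift b z).
Proof.
move=> bb P0 PD Pb; elim=> [|s1 s2 u v r p gu gv _ IH].
  by rewrite (tlift_zero bb).
rewrite (tlift_add bb) tlift_tens //.
by apply: PD IH; exact: Pb p gu gv.
Qed.

(** [tspan_cons] carries no coefficient, so the scalar is absorbed into the left tensor factor. *)
Lemma tspanZ s c z : tspan s z -> tspan s (c *: z).
Proof.
elim=> [|s1 s2 u v r p gu gv _ IH]; first by rewrite scaler0; exact: tspan0.
rewrite scalerDr.
have <- : (c *: u) ⊗ v = c *: (u ⊗ v).
  exact: (scalable_linear ((tens_bilinear H H).1 v)).
by apply: tspan_cons p _ gv IH; exact: gspanZ.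
Qed.

End PermutationSpan.

(** Reindexing [h] by a permutation rearranges [codom h], and every rearrangement arises so. With
    repeated entries the permutation is not unique; any choice serves. *)
Lemma perm_spanP (k : fieldType) (H : hopfAlgType k) n (h : 'I_n -> H) x :
  perm_span h x <-> gspan (codom h) x.
Proof.
have pE (s : {perm 'I_n}) :
    \prod_(i < n) h (s i) = \prod_(y <- [seq h (s i) | i <- enum 'I_n]) y.
  by rewrite big_map enumT [index_enum _]unlock.
split=> [[c ->]|].
  apply: (big_ind (gspan (codom h))); [exact: gspan0 | exact: gspanD |].
  move=> s _; apply: gspanZ; rewrite pE; apply: gspan_prod.
  rewrite (map_comp h s) codomE; apply: perm_map; apply: uniq_perm.
  - by rewrite map_inj_uniq ?enum_uniq //; exact: perm_inj.
  - exact: enum_uniq.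
  move=> i; rewrite mem_enum inE; apply/mapP; exists ((s^-1)%g i).
    by rewrite mem_enum.
  by rewrite permKV.
elim=> [|c t y pt _ [d ->]].
  by exists (fun=> 0); rewrite big1 // => s _; rewrite scale0r.
have [s ts] : exists s : {perm 'I_n}, t = [seq h (s i) | i <- enum 'I_n].
  have /tuple_permP[s ->] : perm_eq t [tuple h i | i < n].
    by rewrite /= -codomE.
  exists s; apply: eq_map => i; exact: tnth_mktuple.
(* The new coefficient goes to the chosen [s] alone, even if other permutations spell the same
   word. *)
exists (fun r => c *+ (r == s) + d r).
rewrite (eq_bigr _ (fun r _ => scalerDl _ _ _)) big_split /=; congr (_ + _).
rewrite (bigD1 s) //= eqxx mulr1n pE -ts [X in _ + X]big1 ?addr0 //.
by move=> r /negPf ->; rewrite mulr0n scale0r.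
Qed.

Section Primitive.
Variables (k : fieldType) (H : hopfAlgType k).
Implicit Types (f g : heis_end H) (s : seq H).

(** Every sequence is the [codom] of its own [tnth], so families and sequences impose the same
    condition. *)
Lemma garsia_reutenauerP f :
  f \in @garsia_reutenauer k H <->
  forall s, (forall y, y \in s -> primitive y) ->
    forall x, gspan s x -> gspan s (f x).
Proof.
split=> [/asboolP fG s ps x|fG].
  have <- : codom (tnth (in_tuple s)) = s.
    by rewrite codomE map_tnth_enum.
  move=> /perm_spanP sx; apply/perm_spanP; apply: fG sx => i.
  by apply: ps; exact: mem_tnth.
apply/asboolP => n h ph x /perm_spanP sx; apply/perm_spanP.
by apply: fG sx => y /codomP[i ->].
Qed.

(** The left counit axiom at a primitive [h] reads [counit h *: 1 + h = h]; cancel [h] and apply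
    [counit]. *)
Lemma counit_primitive (h : H) : primitive h -> counit h = 0 :> k.
Proof.
have bb : bilinear_for *:%R *:%R (fun a b : H => (counit a : k) *: b).
  split=> [v a u u'|u a v v'] /=.
    by rewrite linearP scalerDl [RHS]/= scalerA.
  by rewrite scalerDr !scalerA mulrC.
move=> ph; have := counitl h; rewrite ph (tlift_add bb) !tlift_tens // counit1.
rewrite scale1r -[RHS]add0r => /addIr /(congr1 counit).
by rewrite linearZ /= counit1 linear0 mulr1.
Qed.

(** Induction on the word: multiplying by [a ⊗ 1 + 1 ⊗ a] puts the new letter in front of either the
    left or the right subword. *)
Lemma comul_prod_tspan s : (forall y, y \in s -> primitive y) ->
  tspan s (comul (\prod_(y <- s) y)).
Proof.
elim: s => [|a s IH] ps.
  by rewrite big_nil comul1; apply: (@tspan_tens _ _ _ [::] [::]) => //;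
    exact: gspan_nil1.
have {IH} IH : tspan s (comul (\prod_(y <- s) y)).
  by apply: IH => y ys; apply: ps; rewrite inE ys orbT.
have bten := tens_bilinear H H.
have bin x1 x2 : bilinear_for *:%R *:%R
    (fun y1 y2 : H => (x1 * y1) ⊗ (x2 * y2) : (H ⊗ H)%type).
  split=> [y2|y1].
    apply: (comp_linear (f := fun z => z ⊗ _)); first exact: bten.1.
    exact: mulr_lin_r.
  apply: (comp_linear (f := tens _)); first exact: bten.2.
  exact: mulr_lin_r.
have bout z : bilinear_for *:%R *:%R (fun x1 x2 : H =>
    tlift (fun y1 y2 : H => (x1 * y1) ⊗ (x2 * y2) : (H ⊗ H)%type) z).
  split=> [x2|x1]; apply: tlift_linearP => y1 y2.
    apply: (comp_linear (f := fun z => z ⊗ _)); first exact: bten.1.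
    exact: mulr_lin_l.
  apply: (comp_linear (f := tens _)); first exact: bten.2.
  exact: mulr_lin_l.
(* Writing the coproduct as [tlift tens] of itself makes [tlift_comulM] applicable. *)
rewrite big_cons [comul _]tensor_sum tlift_comulM //.
have -> : comul a = a ⊗ 1 + 1 ⊗ a by apply: ps; exact: mem_head.
have ga := gspan_seq1 a.
rewrite (tlift_add (bout _)) !tlift_tens //; apply: tspanD.
  apply: (tlift_tspan (bin _ _)) IH; [exact: tspan0 | exact: tspanD |].
  move=> s1 s2 u v p gu gv; rewrite mul1r.
  by apply: (tspan_tens _ (gspanM ga gu) gv); rewrite /= perm_cons.
apply: (tlift_tspan (bin _ _)) IH; [exact: tspan0 | exact: tspanD |].
move=> s1 s2 u v p gu gv; rewrite mul1r.
apply: (tspan_tens _ gu (gspanM ga gv)).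
by rewrite perm_catCA /= perm_cons.
Qed.

Lemma comul_gspan s x : (forall y, y \in s -> primitive y) ->
  gspan s x -> tspan s (comul x).
Proof.
move=> ps; elim=> [|c t y pt _ IH]; first by rewrite linear0; exact: tspan0.
rewrite linearP; apply: tspanD IH; apply: tspanZ.
apply: (tspan_perm pt); apply: comul_prod_tspan => z.
by rewrite (perm_mem pt); exact: ps.
Qed.

Lemma heis_inner_bilinear g (b : H) :
  bilinear_for *:%R *:%R (fun x y : H => y * g (b * x)).
Proof.
split=> [y|x]; last exact: mulr_lin_l.
apply: (comp_linear (f := fun z => y * z)); first exact: mulr_lin_r.
by apply: (comp_linear (linear_fun g)); exact: mulr_lin_r.
Qed.

Lemma heis_outer_bilinear f g : bilinear_for *:%R *:%R
  (fun a b : H => tlift (fun x y : H => y * g (b * x)) (comul (f a))).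
Proof.
split=> [b|a].
  apply: (comp_linear (f := fun a => tlift _ (comul a))); last exact: linear_fun.
  apply: (comp_linear (f := tlift _)); last exact: linear_fun.
  exact: tlift_linear (heis_inner_bilinear g b).
apply: tlift_linearP => x y.
apply: (comp_linear (f := fun z => y * z)); first exact: mulr_lin_r.
by apply: (comp_linear (linear_fun g)); exact: mulr_lin_l.
Qed.

(** Since [counit] is multiplicative and vanishes on primitives, the unit kills every nonempty word;
    it sends the empty product 1 to itself. *)
Lemma garsia_reutenauer1 : 1 \in @garsia_reutenauer k H.
Proof.
apply/garsia_reutenauerP => s ps x; rewrite heis1E.
elim=> [|c t y pt _ IH]; first by rewrite linear0 scale0r; exact: gspan0.
rewrite linearP scalerDl; apply: gspanD IH; rewrite -scalerA; apply: gspanZ.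
case: t pt => [|a t] pt.
  by rewrite big_nil counit1 scale1r; apply: (gspan_perm pt); exact: gspan_nil1.
rewrite big_cons counitM counit_primitive ?mul0r ?scale0r; first exact: gspan0.
by apply: ps; rewrite -(perm_mem pt) mem_head.
Qed.

Lemma garsia_reutenauerM f g : f \in @garsia_reutenauer k H ->
  g \in @garsia_reutenauer k H -> f * g \in @garsia_reutenauer k H.
Proof.
move=> /garsia_reutenauerP fG /garsia_reutenauerP gG.
apply/garsia_reutenauerP => s ps x sx; rewrite heisE.
apply: (tlift_tspan (heis_outer_bilinear f g)) (comul_gspan ps sx);
  [exact: gspan0 | exact: gspanD |].
move=> s1 s2 u v p gu gv.
(* Both [fG] and [comul_gspan] ask for primitive letters, which the subword [s1] inherits from
   [s]. *)
have ps1 y : y \in s1 -> primitive y.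
  by move=> ys; apply: ps; rewrite -(perm_mem p) mem_cat ys.
apply: (tlift_tspan (heis_inner_bilinear g v)) (comul_gspan ps1 (fG _ ps1 _ gu));
  [exact: gspan0 | exact: gspanD |].
move=> t1 t2 a b q ga gb.
(* The order is that of [b * g (v * a)]: [g] acts within the span of [s2 ++ t1], and left
   multiplication by [b] adds [t2]. *)
have r : perm_eq (t2 ++ s2 ++ t1) s.
  by apply: perm_trans p; rewrite perm_catCA perm_catC perm_cat2r perm_catC.
apply: (gspan_perm r); apply: gspanM => //; apply: gG; last exact: gspanM.
by move=> y ys; apply: ps; rewrite -(perm_mem r) mem_cat ys orbT.
Qed.

End Primitive.

Theorem theorem5p4 (k : fieldType) (kchar0 : [pchar k] =i pred0)
    (H : hopfAlgType k) :
  GRing.subalg_closed (@garsia_reutenauer k H).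
Proof.
split; [exact: garsia_reutenauer1 | | exact: garsia_reutenauerM].
(* Sums and scalings of endomorphisms are pointwise, so this case rests on each span being a
   subspace. *)
move=> c f g /garsia_reutenauerP fG /garsia_reutenauerP gG.
apply/garsia_reutenauerP => s ps x sx; rewrite heis_addE heis_scaleE.
by apply: gspanD; [apply: gspanZ; exact: fG | exact: gG].
Qed.
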